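(* For integers $m\ge n\ge 0$, the number $M_n(m)$ of merging paths from $(0,0)$ ending at $(n,m)$ is given by $$M_n(m)=2\binom{m+n}{n}\quad\text{for } m>n,\qquad\text{and}\qquad M_n(n)=\binom{2n}{n}.$$
   Context: An arrival sequence of length $\ell\ge 0$ is a binary string $\mathbf{b}=b_1b_2\cdots b_\ell\in\{0,1\}^\ell$. Cars $1,2,\dots,\ell$ arrive in order and choose between two initially empty lanes (left and right): if $b_i=0$, car $i$ enters the right lane; if $b_i=1$, car $i$ enters the currently shorter lane, and enters the right lane if both lanes have the same length. If $b_i=1$ and car $i$ enters the right lane (so the lanes were equal), this is called a bounce. The merging path of $\mathbf{b}$ is the lattice path starting at $(0,0)$ whose $i$-th step is an up step $(0,1)$ if car $i$ enters the right lane and a right step $(1,0)$ if car $i$ enters the left lane, where up steps coming from bounces are decorated. Hence merging paths are in bijection with arrival sequences and are counted per arrival sequence. The path ends at (reaches) $(n,m)$ when $n$ cars are in the left lane and $m$ cars are in the right lane, with $m+n=\ell$. $M_n(m)$ is the number of arrival sequences of length $m+n$ whose merging path ends at $(n,m)$. *)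

(* Defs.v *)
From mathcomp Require Import all_boot.

Set Implicit Arguments.
Unset Strict Implicit.
Unset Printing Implicit Defensive.

(* The entry [true] stands for the letter 1, [false] for 0. *)
Definition arrival_sequence (l : nat) : finType := l.-tuple bool.

(* (number of cars in the left lane, number of cars in the right lane);
   also read as a lattice point. *)
Definition lanes : Type := (nat * nat)%type.

Definition enters_right (p : lanes) (b : bool) : bool :=
  if b then p.2 <= p.1 else true.

Definition bounce (p : lanes) (b : bool) : bool :=
  b && enters_right p b.

(* [UpStep d] is the step (0,1), decorated when [d] is [true];
   [RightStep] is the step (1,0), which is a car entering the LEFT lane. *)
Inductive step : Type :=
  | UpStep of bool
  | RightStep.

Definition car_step (p : lanes) (b : bool) : step :=
  if enters_right p b then UpStep (bounce p b) else RightStep.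

Definition move (p : lanes) (s : step) : lanes :=
  match s with
  | UpStep _ => (p.1, p.2.+1)
  | RightStep => (p.1.+1, p.2)
  end.

Fixpoint merging_path_from (p : lanes) (b : seq bool) : seq step :=
  match b with
  | [::] => [::]
  | bi :: b' =>
      let s := car_step p bi in s :: merging_path_from (move p s) b'
  end.

Definition merging_path (b : seq bool) : seq step :=
  merging_path_from (0, 0) b.

Definition endpoint (w : seq step) : lanes := foldl move (0, 0) w.

(* M n m is M_n(m). *)
Definition M (n m : nat) : nat :=
  #|[set b : arrival_sequence (m + n) | endpoint (merging_path b) == (n, m)]|.

(* Main.v *)
(* Conditioning on the last car gives, for all n and m,
     M_{n+1}(m+1) = (1 + [m <= n+1]) M_{n+1}(m) + [n <= m] M_n(m+1),
   since the step (0,1) into (n+1,m+1) comes from both letters exactly when it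
   can be a bounce.  Below the diagonal this forces M_n(m) = 0; on and above it,
   it reduces to Pascal's rule, the doubling of the coefficient coming from the
   bounce that leaves the diagonal. *)
Require Import Defs.
From mathcomp Require Import all_boot zify.

Definition next (p : lanes) (b : bool) : lanes := move p (car_step p b).

Lemma endpoint_merging_path (b : seq bool) :
  endpoint (merging_path b) = foldl next (0, 0) b.
Proof.
by rewrite /endpoint /merging_path; elim: b (0, 0) => //= x b IH p; exact: IH.
Qed.

Lemma sum_tupleS (l : nat) (f : seq bool -> nat) :
  \sum_(b : l.+1.-tuple bool) f b
  = \sum_(b : l.-tuple bool) f (true :: b)
    + \sum_(b : l.-tuple bool) f (false :: b).
Proof.
rewrite (reindex (fun q : bool * l.-tuple bool => [tuple of q.1 :: q.2])) /=.
  by rewrite -(pair_bigA _ (fun x (b : l.-tuple bool) => f (x :: b))) big_bool.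
exists (fun b => (thead b, [tuple of behead b])) => [[x b] _ | b _] /=.
  by congr pair; apply: val_inj.
by rewrite [RHS]tuple_eta; apply: val_inj.
Qed.

(** Tuples split at their head, but the recurrence conditions on the last car. Induction on [l] with
    the starting point [p] left general carries the split from the front to the end. *)
Lemma sum_foldl_next (l : nat) (p : lanes) (f : lanes -> nat) :
  \sum_(b : l.+1.-tuple bool) f (foldl next p b)
  = \sum_(b : l.-tuple bool)
      (f (next (foldl next p b) true) + f (next (foldl next p b) false)).
Proof.
elim: l p => [|l IH] p.
  rewrite (sum_tupleS 0 (fun b => f (foldl next p b))) -big_split /=.
  by apply: eq_bigr => b _; rewrite tuple0.
rewrite (sum_tupleS l.+1 (fun b => f (foldl next p b))) /= !IH.
by rewrite (sum_tupleS l (fun b => f (next (foldl next p b) true)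
                               + f (next (foldl next p b) false))).
Qed.

(** The length [l] is independent of [n] and [m], so the recurrences need no transport between tuple
    types of equal length. *)
Definition count_paths (l n m : nat) : nat :=
  \sum_(b : l.-tuple bool) (foldl next (0, 0) b == (n, m)).

Lemma M_count_paths (n m : nat) : M n m = count_paths (m + n) n m.
Proof.
rewrite /M /count_paths -sum1dep_card big_mkcond /=.
by apply: eq_bigr => b _; rewrite endpoint_merging_path; case: eqP.
Qed.

Lemma count_paths0 : count_paths 0 0 0 = 1.
Proof.
rewrite /count_paths (eq_bigr (fun=> 1)) => [|b _]; last by rewrite tuple0.
by rewrite sum1_card card_tuple.
Qed.

(** No right step ends in column 0, so the last car starts from [(0, m)]. There letter 1 also gives
    an up step only at the origin, as a bounce. *)
Lemma count_pathsS0 (l m : nat) :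
  count_paths l.+1 0 m.+1 = (m == 0).+1 * count_paths l 0 m.
Proof.
rewrite /count_paths (sum_foldl_next _ _ (fun p => p == (0, m.+1) : nat)).
rewrite big_distrr; apply: eq_bigr => b _.
case: (foldl _ _ _) => x y; rewrite /next /car_step /=.
by case: leqP => /= le_yx; rewrite !xpair_eqE; lia.
Qed.

Lemma count_paths_S0 (l n : nat) : count_paths l.+1 n.+1 0 = 0.
Proof.
rewrite /count_paths (sum_foldl_next _ _ (fun p => p == (n.+1, 0) : nat)).
apply: big1 => b _; case: (foldl _ _ _) => x y; rewrite /next /car_step /=.
by case: leqP => /= le_yx; rewrite !xpair_eqE; lia.
Qed.

Lemma count_pathsSS (l n m : nat) :
  count_paths l.+1 n.+1 m.+1
  = (m <= n.+1).+1 * count_paths l n.+1 m + (n <= m) * count_paths l n m.+1.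
Proof.
rewrite /count_paths (sum_foldl_next _ _ (fun p => p == (n.+1, m.+1) : nat)).
rewrite !big_distrr -big_split; apply: eq_bigr => b _.
case: (foldl _ _ _) => x y; rewrite /next /car_step /=.
by case: leqP => /= le_yx; rewrite !xpair_eqE; nia.
Qed.

Lemma M_S0 (n : nat) : M n.+1 0 = 0.
Proof. by rewrite M_count_paths count_paths_S0. Qed.

Lemma M_0S (m : nat) : M 0 m.+1 = (m == 0).+1 * M 0 m.
Proof. by rewrite !M_count_paths addSn count_pathsS0. Qed.

Lemma M_SS (n m : nat) :
  M n.+1 m.+1 = (m <= n.+1).+1 * M n.+1 m + (n <= m) * M n m.+1.
Proof. by rewrite !M_count_paths addSn count_pathsSS addSnnS. Qed.

Lemma M_lt (n m : nat) : m < n -> M n m = 0.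
Proof.
elim: m n => [|m IH] [|n] // lt_mn; first exact: M_S0.
by rewrite M_SS (IH _ (ltnW lt_mn)) muln0 leqNgt (lt_mn : m < n).
Qed.

(** Pascal's rule gives two summands that are equal by symmetry. This serves the endpoints on the
    diagonal. *)
Lemma central_binS (n : nat) : 'C(2 * n.+1, n.+1) = 2 * 'C(n.+1 + n, n).
Proof.
have -> : 2 * n.+1 = (n.+1 + n).+1 by lia.
by rewrite binS -(bin_sub (leq_addr n n.+1)) addKn addnn mul2n.
Qed.

(** Both cases are proved together, since the recurrence passes between the diagonal and the points
    next to it. *)
Lemma M_eq (n m : nat) :
  n <= m -> M n m = if n < m then 2 * 'C(m + n, n) else 'C(2 * n, n).
Proof.
elim: m n => [|m IHm]; elim=> [|n IHn] //.
- by rewrite M_count_paths count_paths0.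
- by rewrite M_0S IHm // !bin0; case: m {IHm}.
rewrite ltnS => le_nm; rewrite M_SS le_nm mul1n (IHn (leqW le_nm)) ltnS le_nm.
(* On the diagonal the point underneath contributes 0 by [M_lt], so only the right step remains. *)
have [lt_nm | ge_nm] := ltnP n m; last first.
  have -> : m = n by lia.
  by rewrite M_lt // muln0 add0n ltnn central_binS.
rewrite ltnS lt_nm (IHm _ lt_nm) !addSn !addnS [in RHS]binS mulnDr.
have [lt_Snm | ge_Snm] := ltnP n.+1 m; first by rewrite mul1n.
(* The point underneath is now on the diagonal: its value lacks the factor 2, which the bounce
   supplies. *)
have -> : m = n.+1 by lia.
by have -> : 2 * n.+1 = (n.+1 + n).+1 by lia.
Qed.

Theorem theorem2p2 (n m : nat) (le_nm : n <= m) :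
  (n < m -> M n m = 2 * 'C(m + n, n)) /\ M n n = 'C(2 * n, n).
Proof. by split=> [lt_nm|]; rewrite M_eq ?lt_nm ?ltnn. Qed.
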